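(* For every integer $g\ge 3$, the order of a $[1,2;g]$-mixed cage is $\frac{g^2+1}{2}$ if $g$ is odd and $\frac{g^2}{2}$ if $g$ is even.
   Context: A mixed graph is a finite simple graph that may contain both edges and arcs. A $[z,r;g]$-mixed graph is a mixed graph in which every vertex is the tail of exactly $z$ arcs, the head of exactly $z$ arcs, and is incident with exactly $r$ edges, and whose girth is $g$. Walks traverse edges in either direction and arcs only in their direction; a cycle is a closed walk with no repeated vertices (other than start = end) and no repeated edge or arc; the girth is the length of a shortest cycle. A $[z,r;g]$-mixed cage is a $[z,r;g]$-mixed graph of minimum order. *)

(* Defs.v *)
From mathcomp Require Import all_boot.
Set Implicit Arguments. Unset Strict Implicit. Unset Printing Implicit Defensive.

Section MixedGraphs.
Variable V : finType.

(* A mixed graph on vertex set V: an arc relation A (A x y = arc x -> y)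
   and an edge relation E (undirected: symmetric). Simple: no loops, and a
   pair of vertices is not joined by both an edge and an arc. *)
Definition simple_mixed_graph (A E : rel V) : Prop :=
  [/\ irreflexive E, symmetric E, irreflexive A &
      forall x y, E x y -> ~~ A x y].

(* A cycle is encoded as a nonempty sequence of pairs (v_i, b_i): from v_i
   the walk goes to v_{i+1 mod k} through an arc (b_i = true) or an edge
   (b_i = false). Traversals: ((v_i, b_i), v_{i+1}). *)
Definition cyc_steps (c : seq (V * bool)) : seq ((V * bool) * V) :=
  zip c (rot 1 (map fst c)).

Definition step_ok (A E : rel V) (p : (V * bool) * V) : bool :=
  let: ((v, b), w) := p in if b then A v w else E v w.

Definition link_key (p : (V * bool) * V) : ((V * V) + {set V})%type :=
  let: ((v, b), w) := p in if b then inl (v, w) else inr [set v; w].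

Definition is_mixed_cycle (A E : rel V) (c : seq (V * bool)) : Prop :=
  [/\ 0 < size c, uniq (map fst c), all (step_ok A E) (cyc_steps c)
    & uniq (map link_key (cyc_steps c))].

Definition has_girth (A E : rel V) (g : nat) : Prop :=
  (exists c, is_mixed_cycle A E c /\ size c = g) /\
  (forall c, is_mixed_cycle A E c -> g <= size c).

Definition zrg_mixed_graph (z r g : nat) (A E : rel V) : Prop :=
  [/\ simple_mixed_graph A E,
      forall x : V, #|[set y | A x y]| = z,
      forall x : V, #|[set y | A y x]| = z,
      forall x : V, #|[set y | E x y]| = r
    & has_girth A E g].

End MixedGraphs.

Definition is_mixed_cage_order (z r g n : nat) : Prop :=
  (exists A E : rel 'I_n, zrg_mixed_graph z r g A E) /\
  (forall (V : finType) (A E : rel V), zrg_mixed_graph z r g A E -> n <= #|V|).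

(* Main.v *)
(* Lower bound: follow the arcs from any vertex through v_0, ..., v_(g-1) and
   take around v_i the ball of radius min(i, g-1-i) in the edge 2-factor. Edge
   cycles have length at least g, so this ball has 2 min(i, g-1-i) + 1 vertices;
   a common vertex of the balls of v_i and v_j (i < j) would close a walk
   containing an arc and of length at most g - 1. The ball sizes add up to the
   claimed order n.
   Upper bound: on Z/n take the arcs x -> x + 1 and the edges {x, x + k}, where k
   is the odd one of g and g - 1. A closed walk with i arcs and edge
   displacement j k satisfies i + k j = 0 mod n, and the lattice of such (i, j)
   has minimal l^1-norm g. *)
Require Import Defs.
From mathcomp Require Import all_boot all_algebra.
From mathcomp Require Import zify ring.
Set Implicit Arguments. Unset Strict Implicit. Unset Printing Implicit Defensive.

Lemma not_uniq_map_split (T : Type) (U : eqType) (f : T -> U) (s : seq T) :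
  ~~ uniq (map f s) ->
  exists s1 x s2 y s3, s = s1 ++ x :: s2 ++ y :: s3 /\ f x = f y.
Proof.
elim: s => [//|x s IHs] /=; rewrite negb_and negbK.
have [fx_s _|_ /IHs [s1 [y [s2 [z [s3 [-> fyz]]]]]]] := boolP (f x \in map f s).
  suff [s2 [y [s3 [-> fxy]]]] :
    exists s2 y s3, s = s2 ++ y :: s3 /\ f x = f y by exists [::], x, s2, y, s3.
  elim: s fx_s {IHs} => [//|z s IHs] /=; rewrite inE.
  have [fxz _|_ /IHs [s2 [y [s3 [-> fxy]]]]] := eqVneq (f x) (f z).
    by exists [::], z, s.
  by exists (z :: s2), y, s3.
by exists (x :: s1), y, s2, z, s3.
Qed.

(** * Walks, and the cycles they contain *)

Section Walks.
Variables (V : finType) (A E : rel V).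
Implicit Types (x y z : V) (c d : seq (V * bool)).

(** The endpoint [y] is kept outside the list, as the default of [head]. Appending lists then
    concatenates walks, and a closed walk has the format of a cycle. *)
Fixpoint steps_to c y : bool :=
  if c is p :: c' then step_ok A E (p, head y (map fst c')) && steps_to c' y
  else true.

Definition walk x c y := (head y (map fst c) == x) && steps_to c y.

Lemma steps_to_cat c d y :
  steps_to (c ++ d) y = steps_to c (head y (map fst d)) && steps_to d y.
Proof.
by elim: c => [//|p [|q c] IHc]; rewrite /= ?andbT // -andbA -IHc.
Qed.

Lemma walk_cat x y z c d : walk x c y -> walk y d z -> walk x (c ++ d) z.
Proof.
rewrite /walk steps_to_cat => /andP[hx cy] /andP[/eqP hy dz].
by rewrite hy cy dz !andbT; case: c hx {cy} => //=; rewrite hy.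
Qed.

Lemma walk1 x y (b : bool) : (if b then A x y else E x y) -> walk x [:: (x, b)] y.
Proof. by rewrite /walk /= eqxx andbT. Qed.

Lemma walk_iota (f : nat -> V) (b : bool) m n :
  (forall t, if b then A (f t) (f t.+1) else E (f t) (f t.+1)) ->
  walk (f m) [seq (f t, b) | t <- iota m n] (f (m + n)).
Proof.
move=> fS; elim: n m => [|n IHn] m; first by rewrite addn0 /walk /= eqxx.
rewrite addnS -addSn; exact: walk_cat (walk1 (fS m)) (IHn m.+1).
Qed.

Lemma steps_to_edges x s y :
  steps_to [seq (v, false) | v <- x :: s] y = path E x (rcons s y).
Proof. by elim: s x => [|z s IHs] x //=; rewrite -IHs. Qed.

Lemma cyc_stepsE p c : all (step_ok A E) (cyc_steps (p :: c)) = steps_to (p :: c) p.1.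
Proof.
rewrite /cyc_steps [map _ _]/= rot1_cons; move: p.1 => x.
by elim: c p => [|q c IHc] p //=; have := IHc q; rewrite /= => ->.
Qed.

Lemma mixed_cycle_walk c :
  is_mixed_cycle A E c -> exists x, walk x c x.
Proof.
case: c => [[]|p c [_ _ + _]] //; rewrite cyc_stepsE => st.
by exists p.1; rewrite /walk /= eqxx.
Qed.

(** Equal arcs have equal tails. If the edges at positions i < j coincide, distinctness of the
    vertices makes j the successor of i and i the successor of j modulo the length, so the walk runs
    back and forth along one edge: length 2 and no arc. *)
Lemma link_key_uniq c : uniq (map fst c) -> has snd c || (2 < size c) ->
  uniq (map (@link_key V) (cyc_steps c)).
Proof.
case: c => [//|p0 c']; set c := p0 :: c' => c_uniq c_nt.
have szr : size (rot 1 (map fst c)) = size c by rewrite size_rot size_map.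
have szs : size (cyc_steps c) = size c by rewrite size_zip szr minnn.
pose v i := nth p0.1 (map fst c) i.
have vinj i j : v i = v j -> i < size c -> j < size c -> i = j.
  move=> /[swap] ic /[swap] jc /eqP; rewrite nth_uniq ?size_map //; exact: eqP.
have vrot i : i < size c -> nth p0.1 (rot 1 (map fst c)) i = v (i.+1 %% size c).
  move=> ic; rewrite /c [map _ _]/= rot1_cons nth_rcons size_map.
  have [ic'|] := ltnP i (size c').
    by rewrite modn_small.
  move: (ic); rewrite /c /= ltnS leq_eqVlt ltnNge => /orP[/eqP->|/negP//].
  by rewrite eqxx modnn.
have keyE i : i < size c -> nth (inr set0) (map (@link_key V) (cyc_steps c)) i =
    link_key ((v i, nth false (map snd c) i), v (i.+1 %% size c)).
  move=> ic; rewrite (nth_map (p0, p0.1)) ?szs // nth_zip ?szr // vrot //.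
  congr (link_key (_, _)); rewrite /v (nth_map p0) // (nth_map p0) //.
  by case: (nth p0 c i).
have sc0 : 0 < size c by [].
have modS i : i.+1 %% size c < size c by rewrite ltn_pmod.
suff keyN i j : i < j -> j < size c ->
    nth (inr set0) (map (@link_key V) (cyc_steps c)) i <>
    nth (inr set0) (map (@link_key V) (cyc_steps c)) j.
  apply/(uniqP (inr set0)) => i j; rewrite !inE size_map szs => ic jc eqij.
  have [lij|lji|//] := ltngtP i j; first by case: (keyN i j lij jc).
  by case: (keyN j i lji ic).
move=> ij jc; have ic := ltn_trans ij jc; rewrite !keyE //=.
case bi: (nth false _ i); case bj: (nth false _ j) => //.
  by case=> /vinj /(_ ic jc) eij _; rewrite eij ltnn in ij.
case=> eqs.
have : v i \in [set v j; v (j.+1 %% size c)] by rewrite -eqs set21.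
have : v j \in [set v i; v (i.+1 %% size c)] by rewrite eqs set21.
rewrite !inE => /orP[/eqP/vinj|/eqP/vinj].
  by move=> /(_ jc ic) eij; rewrite eij ltnn in ij.
move=> /(_ jc (modS i)) ej /orP[/eqP/vinj|/eqP/vinj].
  by move=> /(_ ic jc) eij; rewrite eij ltnn in ij.
move=> /(_ ic (modS j)) ei.
have {}ej : j = i.+1 by rewrite ej modn_small //; apply: leq_ltn_trans jc.
have i2 : i.+2 = size c.
  apply/eqP; rewrite eqn_leq -{1}ej jc leqNgt; apply/negP=> lt.
  by move: ei; rewrite ej modn_small // => /eqP; rewrite -addn2 -{1}[i]addn0 eqn_add2l.
have i0 : i = 0 by rewrite ei ej i2 modnn.
move: c_nt bi bj; rewrite -i2 ej i0 orbF; move: i2; rewrite i0 /c /=.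
by case: (c') => [//|q [|//]] _ /= /orP[->|] // /orP[->|].
Qed.

Lemma simple_closed_walk_cycle c x : 0 < size c -> walk x c x ->
  uniq (map fst c) -> has snd c || (2 < size c) -> is_mixed_cycle A E c.
Proof.
move=> c0 /andP[/eqP hx st] cu cn; split=> //; last exact: link_key_uniq.
by case: c c0 hx st {cu cn} => // p c _ /= hx; rewrite cyc_stepsE hx.
Qed.

(* A closed walk is cut at a repeated vertex into two closed walks, and one
   of them still contains an arc; an arc also prevents the degenerate cycle
   that traverses one edge back and forth. *)
Lemma closed_walk_cycle c x : walk x c x -> has snd c ->
  exists2 d, is_mixed_cycle A E d & size d <= size c.
Proof.
have [m] := ubnP (size c); elim: m c x => // m IHm c x; rewrite ltnS => cm wc ca.
have [cu|] := boolP (uniq (map fst c)).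
  exists c => //; apply: (simple_closed_walk_cycle _ wc); rewrite ?ca //.
  by case: (c) ca.
case/not_uniq_map_split=> c1 [p [c2 [q [c3 [ec epq]]]]].
move: wc; rewrite /walk ec.
rewrite steps_to_cat -cat_cons steps_to_cat => /and3P[hx w1 /andP[w2 w3]].
move: cm ca; rewrite ec has_cat -cat_cons has_cat !size_cat => cm.
rewrite orbCA => /orP[a2|a13].
  have [||d cd sd] := IHm (p :: c2) p.1 _ _ a2.
  - by apply: leq_trans cm; rewrite /=; lia.
  - by rewrite /walk /= eqxx epq.
  - by exists d => //; apply: leq_trans sd _; rewrite /=; lia.
have [|||d cd sd] := IHm (c1 ++ q :: c3) x.
- by apply: leq_trans cm; rewrite size_cat /=; lia.
- rewrite /walk steps_to_cat w3 andbT [head x (map fst (q :: c3))]/= -epq w1 andbT.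
  by case: (c1) hx => [|r c1'] //=; rewrite epq.
- by rewrite has_cat.
- by exists d => //; apply: leq_trans sd _; rewrite size_cat /=; lia.
Qed.

(** * Balls in the edge 2-factor *)

Fixpoint edge_ball r x : {set V} :=
  if r is r'.+1 then edge_ball r' x :|: [set y | [exists z in edge_ball r' x, E z y]]
  else [set x].

Hypothesis symE : symmetric E.

(** Edges can be reversed, so the centre is linked to each point of the ball in both directions; the
    disjointness argument leaves one ball and enters another. *)
Lemma edge_ball_walk r x y : y \in edge_ball r x ->
  exists c d, [/\ walk x c y, walk y d x, size c <= r & size d <= r].
Proof.
elim: r y => [|r IHr] y /=.
  by rewrite inE => /eqP->; exists [::], [::]; rewrite /walk /= eqxx.
rewrite !inE => /orP[/IHr[c [d [? ? ? ?]]]|].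
  by exists c, d; split=> //; apply: leqW.
case/existsP=> z /andP[/IHr[c [d [wc wd sc sd]]] Ezy].
exists (c ++ [:: (z, false)]), ((y, false) :: d); split=> //.
- exact: walk_cat wc (walk1 (b := false) Ezy).
- by rewrite symE in Ezy; apply: walk_cat (walk1 (b := false) Ezy) wd.
- by rewrite size_cat addn1.
Qed.

Variable g : nat.
Hypothesis irrE : irreflexive E.
Hypothesis degE : forall x, #|[set y | E x y]| = 2.
Hypothesis girth_ge : forall c, is_mixed_cycle A E c -> g <= size c.

(** The candidate is the neighbour of [x] that does not follow it on the path. If it lay on the
    path, the segment up to it would close into an edge cycle with at most [(size s).+1] vertices,
    fewer than [g]. *)
Lemma edge_path_extend x s : uniq (x :: s) -> path E x s -> size s < g.-1 ->
  exists2 y, E y x & y \notin x :: s.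
Proof.
move=> su sp sg.
(* For empty [s] the removed vertex is [x] itself, which is not its own neighbour. *)
have [y] : exists y, y \in [set y | E x y] :\ head x s.
  apply/set0Pn; rewrite -card_gt0.
  by have := cardsD1 (head x s) [set y | E x y]; rewrite degE; case: (_ \in _) => /=; lia.
rewrite !inE => /andP[yh Exy]; exists y; first by rewrite symE.
rewrite inE negb_or; have [yx|yNx] /= := eqVneq y x; first by rewrite yx irrE in Exy.
apply/negP => ys.
case: s su sp sg yh ys => [//|z s] su sp sg /= yz; rewrite inE (negPf yz) /= => ys.
case/splitPr: ys su sp sg => s1 s2 su sp sg.
have : is_mixed_cycle A E [seq (v, false) | v <- [:: y, x, z & s1]].
  apply: (@simple_closed_walk_cycle _ y) => //; last by rewrite orbT.
    rewrite /walk /= eqxx /= symE Exy /=.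
    have := steps_to_edges z s1 y; rewrite /= => ->.
    by move: sp; rewrite /= => /andP[-> +]; rewrite rcons_path cat_path /= => /and3P[-> -> _].
  rewrite -map_comp map_id.
  move: su; rewrite -!cat_cons cat_uniq => /and3P[u1 + _].
  by rewrite [has _ _]/= negb_or => /andP[yN _]; rewrite cons_uniq u1 andbT.
move/girth_ge; rewrite size_map /= leqNgt => /negP[].
by move: sg; rewrite /= size_cat /=; lia.
Qed.

(** A simple edge path on 2r + 1 vertices inside the ball is lengthened by one vertex at each end
    when the radius grows by one. *)
Lemma leq_card_edge_ball r x : r.*2 < g -> r.*2.+1 <= #|edge_ball r x|.
Proof.
suff H : r.*2 < g -> exists z s, [/\ uniq (z :: s), path E z s, size s = r.*2
    & {subset z :: s <= edge_ball r x}].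
  move=> /H[z [s [su _ <- ss]]]; rewrite -(card_uniqP su : _ = (size s).+1).
  by apply: subset_leq_card; apply/subsetP.
elim: r => [|r IHr] rg; first by exists x, [::]; split=> // y; rewrite !inE.
case: IHr => [|z [s [su sp sz ss]]]; first by lia.
have grow y u : y \in edge_ball r x -> E y u -> u \in edge_ball r.+1 x.
  by move=> yb Eyu; rewrite !inE; apply/orP; right; apply/existsP; exists y; rewrite yb.
have [|y Eyz yN] := edge_path_extend su sp; first by rewrite sz; lia.
(* Paths are extended at their first vertex, so the path is reversed to reach its other end
   [last z s]. *)
pose l := rev (y :: z :: s).
have lu : uniq l by rewrite rev_uniq /= yN.
have lp : sorted E l.
  by rewrite rev_sorted /= symE Eyz (eq_path (e' := E)) // => a b; exact: symE.
have el : l = last z s :: rev (y :: belast z s).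
  by rewrite /l -rev_rcons rcons_cons -lastI.
rewrite el /= in lu lp.
have [|w Ewl wN] := edge_path_extend (lu : uniq (_ :: _)) lp.
  by rewrite size_rev /= size_belast sz; lia.
exists w, l; split.
- by rewrite el [uniq _]/= wN.
- by rewrite el /= Ewl.
- by rewrite /l size_rev /= sz doubleS.
move=> u; rewrite inE mem_rev inE => /or3P[/eqP->|/eqP->|us].
- by apply: (grow (last z s)); [apply/ss; rewrite mem_last | rewrite symE].
- by apply: (grow z); [apply/ss; rewrite mem_head | rewrite symE].
- by rewrite /= inE ss.
Qed.

(** * The lower bound: disjoint balls along a walk of arcs *)

Hypothesis outA : forall x, #|[set y | A x y]| = 1.

Lemma sum_card_disjoint (I : finType) (B : I -> {set V}) :
  (forall i j x, x \in B i -> x \in B j -> i = j) -> \sum_i #|B i| <= #|V|.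
Proof.
move=> Bdis; rewrite (eq_bigr (fun i => \sum_x (x \in B i))); last first.
  by move=> i _; rewrite -sum1_card big_mkcond; apply: eq_bigr => x _; case: (x \in _).
rewrite exchange_big /= -sum1_card; apply: leq_sum => x _.
have [i xi|xN] := pickP (fun i => x \in B i); last by rewrite big1 // => i _; rewrite xN.
rewrite (bigD1 i) //= xi big1 // => j; apply: contraNeq; rewrite eqb0 negbK => xj.
by rewrite (Bdis _ _ _ xj xi).
Qed.

Lemma order_ge_sum_balls (x0 : V) :
  \sum_(i < g) (minn i (g.-1 - i)).*2.+1 <= #|V|.
Proof.
have /fin_all_exists [f Af] : forall x, exists y, A x y.
  move=> x; have [y] : exists y, y \in [set y | A x y].
    by apply/set0Pn; rewrite -card_gt0 outA.
  by rewrite inE; exists y.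
pose v i := iter i f x0.
pose B (i : 'I_g) := edge_ball (minn i (g.-1 - i)) (v i).
apply: (@leq_trans (\sum_i #|B i|)).
  by apply: leq_sum => i _; apply: leq_card_edge_ball; have := ltn_ord i; lia.
apply: sum_card_disjoint.
suff H (i j : 'I_g) x : i < j -> x \in B i -> x \in B j -> False.
  move=> i j x xi xj; apply/val_inj => /=.
  by have [/H /(_ xi xj)|/H /(_ xj xi)|] := ltngtP (i : nat) j.
move=> ij /edge_ball_walk[_ [d [_ wd _ sd]]] /edge_ball_walk[c [_ [wc _ sc _]]].
have wa := @walk_iota v true i (j - i) (fun t => Af (v t)).
rewrite subnKC ?(ltnW ij) // in wa.
have [|e /girth_ge] := closed_walk_cycle (walk_cat wa (walk_cat wc wd)).
  by case: (j - i) (subn_gt0 i j) => [|n]; rewrite ?ij.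
(* The closed walk has length at most (j - i) + (g - 1 - j) + i = g - 1. *)
rewrite !size_cat size_map size_iota => ge le.
have := leq_trans ge le; have := ltn_ord j; lia.
Qed.

End Walks.

(** Induction from g to g + 2: two balls of radius 0 appear at the ends and every inner radius grows
    by one, so the sum grows by 2g + 2, half of (g + 2)^2 - g^2. *)
Lemma sum_ball_sizes g :
  \sum_(i < g) (minn i (g.-1 - i)).*2.+1 =
    if odd g then (g ^ 2).+1 %/ 2 else g ^ 2 %/ 2.
Proof.
suff H : (\sum_(i < g) (minn i (g.-1 - i)).*2.+1).*2 = g ^ 2 + odd g.
  by case: odd H => H; lia.
have [m] := ubnP g; elim: m g => // m IHm [|[|g]] gm.
- by rewrite big_ord0.
- by rewrite big_ord1.
rewrite big_ord_recl big_ord_recr /=.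
have -> : \sum_(i < g) (minn (bump 0 i) (g.+1 - bump 0 i)).*2.+1 =
    \sum_(i < g) ((minn i (g.-1 - i)).*2.+1 + 2).
  apply: eq_bigr => i _; rewrite /bump /=; have := ltn_ord i; lia.
rewrite big_split /= sum_nat_const card_ord negbK.
have := IHm g; rewrite /bump /=; lia.
Qed.

(** * The circulant mixed graph on Z/n *)

Section Circulant.
Import GRing.Theory Num.Theory.
Local Open Scope ring_scope.
Variables (n k g : nat).
Hypothesis n_gt0 : (0 < n)%N.
Hypothesis g_ge3 : (3 <= g)%N.
Hypothesis short_relation : forall i j : int,
  (n%:Z %| i + k%:Z * j)%Z -> (`|i| + `|j| < g)%N -> i = 0 /\ j = 0.

(** Congruences modulo [n] are stated as divisibility of integer differences, so that their
    quotients combine linearly. *)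
Definition circ_arc (x y : 'I_n) := (n%:Z %| y%:Z - (x%:Z + 1))%Z.
Definition circ_edge (x y : 'I_n) :=
  (n%:Z %| y%:Z - (x%:Z + k%:Z))%Z || (n%:Z %| y%:Z - (x%:Z - k%:Z))%Z.

Lemma residue_subproof (z : int) : (`|(z %% n%:Z)%Z| < n)%N.
Proof.
have := ltz_pmod z (n_gt0 : 0 < n%:Z); have := modz_ge0 z (d := n%:Z); lia.
Qed.

Definition residue z : 'I_n := Ordinal (residue_subproof z).

Lemma residueP z : (n%:Z %| (residue z)%:Z - z)%Z.
Proof.
apply/dvdzP; exists (- (z %/ n%:Z)%Z); rewrite /= gez0_abs.
  by rewrite {2}(divz_eq z n%:Z); ring.
by apply: modz_ge0; lia.
Qed.

Lemma ord_eq_dvdz (x y : 'I_n) : (n%:Z %| x%:Z - y%:Z)%Z -> x = y.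
Proof.
case/dvdzP=> q eq; apply/val_inj => /=; have := ltn_ord x; have := ltn_ord y.
have [q1|[q1|q0]] : q <= -1 \/ 1 <= q \/ q = 0 by lia.
- nia.
- nia.
- by move: eq; rewrite q0; lia.
Qed.

Lemma card_residue_class z : #|[set y : 'I_n | (n%:Z %| y%:Z - z)%Z]| = 1%N.
Proof.
rewrite -(cards1 (residue z)); apply: eq_card => y; rewrite !inE.
apply/idP/eqP => [/dvdzP[q eq]|->]; last exact: residueP.
apply: ord_eq_dvdz; have /dvdzP[q' eq'] := residueP z.
apply/dvdzP; exists (q - q'); lia.
Qed.

Lemma circ_edge_sym : symmetric circ_edge.
Proof.
by move=> x y; rewrite /circ_edge orbC; congr (_ || _);
  apply/dvdzP/dvdzP=> -[q eq]; exists (- q); lia.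
Qed.

Lemma circ_edge_irr : irreflexive circ_edge.
Proof.
move=> x; apply/negbTE/negP => /orP[] /dvdzP[q eq].
  have [] := @short_relation 0 1; [apply/dvdzP; exists (- q)| |]; lia.
have [] := @short_relation 0 1; [apply/dvdzP; exists q| |]; lia.
Qed.

(** Each coincidence to exclude is a relation of l^1-norm at most 2, below [g]: a loop arc gives (1,
    0), an arc along an edge gives (1, -1) or (1, 1). *)
Lemma circ_simple : simple_mixed_graph circ_arc circ_edge.
Proof.
split; [exact: circ_edge_irr | exact: circ_edge_sym | |].
  move=> x; apply/negbTE/negP => /dvdzP[q eq].
  have [] := @short_relation 1 0; [apply/dvdzP; exists (- q)| |]; lia.
move=> x y /orP[] /dvdzP[q eq]; apply/negP => /dvdzP[q' eq'].
  have [] := @short_relation 1 (-1); [apply/dvdzP; exists (q - q')| |]; lia.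
have [] := @short_relation 1 1; [apply/dvdzP; exists (q - q')| |]; lia.
Qed.

Lemma circ_edge_deg x : #|[set y | circ_edge x y]| = 2%N.
Proof.
have -> : [set y | circ_edge x y] =
    [set y : 'I_n | (n%:Z %| y%:Z - (x%:Z + k%:Z))%Z] :|:
    [set y : 'I_n | (n%:Z %| y%:Z - (x%:Z - k%:Z))%Z].
  by apply/setP=> y; rewrite !inE.
rewrite cardsU !card_residue_class; set I := _ :&: _.
suff -> : I = set0 by rewrite cards0.
(* If x + k and x - k agreed, 2k would vanish modulo n: the relation (0, 2). *)
apply/eqP/set0Pn => -[y]; rewrite !inE => /andP[/dvdzP[q eq] /dvdzP[q' eq']].
have [] := @short_relation 0 2; [apply/dvdzP; exists (q' - q)| |]; lia.
Qed.

(** [j] counts the edges run as +k minus those run as -k, so its absolute value is at most the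
    number of edges of the walk. *)
Lemma circ_walk_displacement x c y : walk circ_arc circ_edge x c y ->
  exists2 j : int, (n%:Z %| y%:Z - x%:Z - (count snd c)%:Z - k%:Z * j)%Z &
    (count snd c + `|j| <= size c)%N.
Proof.
elim: c x => [|[u b] c IHc] x; rewrite /walk /=.
  by case/andP=> /eqP-> _; exists 0 => //; apply/dvdzP; exists 0; lia.
case/andP=> /eqP-> {u} /andP[st wc]; set z := head _ _ in st.
have [|j /dvdzP[q eq] jc] := IHc z; first by rewrite /walk eqxx.
clearbody z; move: (count snd c) (size c) eq jc => m l eq jc.
case: b st => [/dvdzP[q' eq']|/orP[]/dvdzP[q' eq']]; rewrite ?add1n ?add0n.
- exists j; last by lia.
  by apply/dvdzP; exists (q + q'); lia.
- exists (j + 1); last by lia.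
  by apply/dvdzP; exists (q + q'); lia.
- exists (j - 1); last by lia.
  by apply/dvdzP; exists (q + q'); lia.
Qed.

(* A cycle of edges cannot turn back, so it keeps going in one direction. *)
Lemma circ_edge_cycle_straight (f : nat -> 'I_n) (m : nat) :
  (forall t, (t < m)%N -> circ_edge (f t) (f t.+1)) ->
  (forall t, (t.+1 < m)%N -> f t <> f t.+2) ->
  exists2 s : int, `|s|%N = 1%N & (n%:Z %| (f m)%:Z - (f 0%N)%:Z - k%:Z * (s * m%:Z))%Z.
Proof.
case: m => [|m] fE fN; first by exists 1 => //; rewrite subrr !mulr0 subr0 dvdz0.
have [s s1 f01] : exists2 s : int, `|s|%N = 1%N & (n%:Z %| (f 1%N)%:Z - (f 0%N)%:Z - k%:Z * s)%Z.
  have /orP[] := fE 0%N isT => /dvdzP[q eq].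
    by exists 1 => //; apply/dvdzP; exists q; lia.
  by exists (-1) => //; apply/dvdzP; exists q; lia.
exists s => //.
have step t : (t < m.+1)%N -> (n%:Z %| (f t.+1)%:Z - (f t)%:Z - k%:Z * s)%Z.
  elim: t => [//|t IHt] tm; have /dvdzP[q eq] := IHt (ltnW tm).
  have back : (n%:Z %| (f t.+2)%:Z - (f t.+1)%:Z + k%:Z * s)%Z -> False.
    case/dvdzP=> q' eq'; apply: (fN t tm); apply: ord_eq_dvdz.
    by apply/dvdzP; exists (- q - q'); lia.
  have [es|es] : s = 1 \/ s = -1 by lia.
    have /orP[] := fE _ tm => /dvdzP[q' eq'].
      by apply/dvdzP; exists q'; rewrite es; lia.
    by case: back; apply/dvdzP; exists q'; rewrite es; lia.
  have /orP[] := fE _ tm => /dvdzP[q' eq'].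
    by case: back; apply/dvdzP; exists q'; rewrite es; lia.
  by apply/dvdzP; exists q'; rewrite es; lia.
suff H t : (t <= m.+1)%N -> (n%:Z %| (f t)%:Z - (f 0%N)%:Z - k%:Z * (s * t%:Z))%Z by exact: H.
elim: t => [|t IHt] tm; first by rewrite subrr !mulr0 subr0 dvdz0.
have /dvdzP[q eq] := IHt (ltnW tm); have /dvdzP[q' eq'] := step t tm.
by apply/dvdzP; exists (q + q'); rewrite intS; lia.
Qed.

(** A shorter cycle would give a nonzero short relation: with an arc, its first coordinate, the
    number of arcs, is positive; without arcs, the cycle is straight and its second coordinate is
    plus or minus its length. *)
Lemma circ_girth_ge c : is_mixed_cycle circ_arc circ_edge c -> (g <= size c)%N.
Proof.
move=> cyc; rewrite leqNgt; apply/negP => cg.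
have [x wc] := mixed_cycle_walk cyc.
have [ca|cN] := boolP (has snd c).
  have [j /dvdzP[q eq] jc] := circ_walk_displacement wc.
  have [] := @short_relation (count snd c)%:Z j.
  - by apply/dvdzP; exists (- q); lia.
  - exact: leq_ltn_trans jc cg.
  by rewrite has_count in ca; lia.
have ec : c = [seq (v, false) | v <- map fst c].
  rewrite -map_comp -[LHS]map_id; apply/eq_in_map => -[v b] vc /=; congr (_, _).
  by apply/negbTE; apply: contra cN => b1; apply/hasP; exists (v, b).
move: cyc cg; rewrite {}ec; move: (map _ c) => {x wc cN} [|x s]; first by case.
rewrite size_map => -[_ + + +] sg; rewrite -map_comp map_id => us.
rewrite [map _ _]/= cyc_stepsE => st.
have {st} : path circ_edge x (rcons s x).
  by rewrite -(steps_to_edges circ_arc); move: st.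
move=> sp lk.
(* One vertex would mean a loop, and two vertices would use the same edge twice. *)
have s2 : (1 < size s)%N.
  case: s us sp lk {sg} => [|y [|//]] us; first by rewrite /= circ_edge_irr.
  by move=> _; rewrite /cyc_steps /= inE setUC eqxx.
pose f t := nth x (x :: rcons s x) t.
have fx t : (t < (size s).+1)%N -> f t = nth x (x :: s) t.
  by move=> ts; rewrite /f -rcons_cons nth_rcons /= ts.
have fl : f (size s).+1 = x by rewrite /f /= nth_rcons ltnn eqxx.
have ne i j : (i < j)%N -> (j < (size s).+1)%N -> nth x (x :: s) i <> nth x (x :: s) j.
  move=> ij js /eqP; rewrite nth_uniq ?(ltn_trans ij js) //; exact/negP/negbT/ltn_eqF.
have [|t ts|r r1] := @circ_edge_cycle_straight f (size s).+1.
- by move=> t ts; move/(pathP x): sp => /(_ t); rewrite size_rcons => /(_ ts).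
- rewrite fx ?(ltnW ts) //; move: ts; rewrite leq_eqVlt => /orP[/eqP[et]|ts].
    (* At the wrap-around [f t.+2] is [x] again; [t] is positive because the cycle has at least
       three vertices. *)
    rewrite et fl; apply/nesym/(ne 0%N t); last by rewrite -et.
    by move: s2; rewrite -et.
  by rewrite fx //; apply: ne.
rewrite fl /f /= subrr sub0r => rel.
have [] := @short_relation 0 (r * (size s).+1%:Z).
- by rewrite add0r -rpredN.
- by rewrite abszM r1 mul1n.
by move=> _ /eqP; rewrite mulf_eq0 => /orP[] /eqP r0 //; rewrite r0 in r1.
Qed.

(** [a] arcs followed by [b] edges in direction +k close up since a + kb = n. This closed walk of
    length g contains an arc, hence yields a cycle of length at most g. *)
Lemma circ_mixed_graph a b : (0 < a)%N -> (a + b = g)%N -> (a + k * b = n)%N ->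
  zrg_mixed_graph 1 2 g circ_arc circ_edge.
Proof.
move=> a0 abg abn; split; first exact: circ_simple.
- by move=> x; apply: card_residue_class.
- move=> x; rewrite -(card_residue_class (x%:Z - 1)); apply: eq_card => y.
  by rewrite !inE; apply/dvdzP/dvdzP=> -[q eq]; exists (- q); lia.
- exact: circ_edge_deg.
have wA : walk circ_arc circ_edge (residue 0%N)
    [seq (residue t%:Z, true) | t <- iota 0 a] (residue (0 + a)%N).
  pose f t := residue t%:Z; apply: (walk_iota (f := f)) => t.
  have /dvdzP[q eq] := residueP t; have /dvdzP[q' eq'] := residueP t.+1.
  by apply/dvdzP; exists (q' - q); rewrite /f; lia.
pose h t := residue (a%:Z + k%:Z * t%:Z).
have wE : walk circ_arc circ_edge (h 0%N) [seq (h t, false) | t <- iota 0 b] (h (0 + b)%N).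
  apply: walk_iota => t; apply/orP; left.
  have /dvdzP[q eq] := residueP (a%:Z + k%:Z * t%:Z).
  have /dvdzP[q' eq'] := residueP (a%:Z + k%:Z * t.+1%:Z).
  by apply/dvdzP; exists (q' - q); rewrite /h; lia.
have h0 : h 0%N = residue (0 + a)%N by rewrite /h mulr0 addr0.
have hb : h (0 + b)%N = residue 0%N.
  apply: ord_eq_dvdz.
  have /dvdzP[q eq] := residueP (a%:Z + k%:Z * b%:Z).
  have /dvdzP[q' eq'] := residueP 0%N.
  by apply/dvdzP; exists (q - q' + 1); rewrite /h add0n; lia.
rewrite h0 hb in wE.
have [|c cc sc] := closed_walk_cycle (walk_cat wA wE).
  by rewrite has_cat; case: (a) a0.
split; last exact: circ_girth_ge.
exists c; split=> //; apply/eqP; rewrite eqn_leq circ_girth_ge // andbT.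
by rewrite size_cat !size_map !size_iota abg in sc.
Qed.

End Circulant.

(** * Minimal l^1-norm of the relation lattices *)

Section ShortRelations.
Import GRing.Theory Num.Theory.
Local Open Scope ring_scope.

Lemma dvdz_small (n : nat) (z : int) : (n%:Z %| z)%Z -> (`|z| < n)%N -> z = 0.
Proof.
rewrite dvdzE /= => nz zn; apply/eqP; rewrite -absz_eq0; apply: contraLR zn.
by rewrite -lt0n -leqNgt => z0; apply: dvdn_leq.
Qed.

(* The lattice of relations has basis (e + 1, e), (e, - (e + 1)), of
   determinant - n; X0 and Y0 say that both coordinates of (i, j) vanish. *)
Lemma short_relation_odd (e n g : nat) (i j : int) :
  g = (2 * e).+1%N -> n = (2 * (e * e + e)).+1%N ->
  (n%:Z %| i + g%:Z * j)%Z -> (`|i| + `|j| < g)%N -> i = 0 /\ j = 0.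
Proof.
move=> gE nE /dvdzP[q eq] ij.
have gE' : g%:Z = 2 * e%:Z + 1 by lia.
have nE' : n%:Z = 2 * (e%:Z * e%:Z + e%:Z) + 1 by lia.
(* Since |i| + |j| is at most 2e, the combination is at most 2e(e + 1) = n - 1. *)
have bound (a b : int) : (`|a| <= e.+1)%N -> (`|b| <= e.+1)%N ->
    (`|(a * i + b * j)%R| < n)%N.
  move=> ae be.
  have : (`|(a * i + b * j)%R| <= `|(a * i)%R| + `|(b * j)%R|)%N by lia.
  rewrite !abszM; nia.
have X0 : (e%:Z + 1) * i + e%:Z * j = 0.
  apply: (@dvdz_small n); last by apply: bound; lia.
  by apply/dvdzP; exists ((e%:Z + 1) * q - j); rewrite mulrBl -mulrA -eq nE' gE'; ring.
have Y0 : e%:Z * i + (- (e%:Z + 1)) * j = 0.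
  apply: (@dvdz_small n); last by apply: bound; lia.
  by apply/dvdzP; exists (e%:Z * q - j); rewrite mulrBl -mulrA -eq nE' gE'; ring.
have n0 : n%:Z != 0 by rewrite nE.
split; apply: (mulfI n0); rewrite mulr0.
  (* The basis change is inverted using (e + 1)^2 + e^2 = n. *)
  have -> : n%:Z * i = (e%:Z + 1) * ((e%:Z + 1) * i + e%:Z * j)
    + e%:Z * (e%:Z * i + (- (e%:Z + 1)) * j) by rewrite nE'; ring.
  by rewrite X0 Y0 !mulr0.
have -> : n%:Z * j = e%:Z * ((e%:Z + 1) * i + e%:Z * j)
  - (e%:Z + 1) * (e%:Z * i + (- (e%:Z + 1)) * j) by rewrite nE'; ring.
by rewrite X0 Y0 !mulr0 subrr.
Qed.

(** Here n = mg. Modulo g the relation reads i = j, and |i - j| < g makes this an equality of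
    integers. Then n divides gj, so m divides j, while 2|j| < 2m. *)
Lemma short_relation_even (m n g : nat) (i j : int) : (0 < m)%N ->
  g = (2 * m)%N -> n = (2 * (m * m))%N ->
  (n%:Z %| i + g.-1%:Z * j)%Z -> (`|i| + `|j| < g)%N -> i = 0 /\ j = 0.
Proof.
move=> m0 gE nE /dvdzP[q eq] ij.
have gE' : g.-1%:Z = 2 * m%:Z - 1 by lia.
have nE' : n%:Z = 2 * (m%:Z * m%:Z) by lia.
have {}ij0 : i - j = 0.
  apply: (@dvdz_small g); last by lia.
  apply/dvdzP; exists (m%:Z * q - j).
  have -> : i = q * n%:Z - g.-1%:Z * j by rewrite -eq; ring.
  by rewrite nE' gE' gE PoszM; ring.
have j0 : j = 0.
  apply: (@dvdz_small m); last by lia.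
  have m2 : (2 * m%:Z : int) != 0 by lia.
  apply/dvdzP; exists q; apply: (mulfI m2).
  transitivity (i + g.-1%:Z * j); last by rewrite eq nE'; ring.
  by rewrite (subr0_eq ij0) gE'; ring.
by split=> //; rewrite (subr0_eq ij0).
Qed.

End ShortRelations.

(** * Both bounds at the claimed order *)

Theorem theorem7 (g : nat) : 3 <= g ->
  is_mixed_cage_order 1 2 g (if odd g then (g ^ 2).+1 %/ 2 else g ^ 2 %/ 2).
Proof.
move=> g3; split; last first.
  move=> V A E [[irrE symE _ _] outA _ degE [[c [_ cg]] girth]].
  rewrite -sum_ball_sizes.
  (* The cycle of length [g] is nonempty and supplies the starting vertex. *)
  by case: c cg => [|p c] cg; [rewrite -cg in g3 | apply: (order_ge_sum_balls symE irrE degE girth outA p.1)].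
set n := if odd g then _ else _.
have n_eq : n.*2 = g ^ 2 + odd g by rewrite /n; case og : (odd g); lia.
pose k := if odd g then g else g.-1.
exists (@circ_arc n), (@circ_edge n k).
have g_eq : g = odd g + 2 * g./2 by rewrite mul2n odd_double_half.
have n_gt0 : 0 < n by nia.
(* The closed walk has ceil(g/2) arcs and floor(g/2) edges: (e + 1) + (2e + 1)e = n for g = 2e + 1,
   and m + (2m - 1)m = n for g = 2m. *)
apply: (circ_mixed_graph n_gt0 g3 _ (a := uphalf g) (b := g./2)).
- move=> i j; rewrite /k; case og: (odd g) g_eq n_eq => g_eq n_eq.
    by apply: short_relation_odd g_eq _; nia.
  by apply: (short_relation_even _ g_eq); nia.
- by rewrite uphalf_half; lia.
- by rewrite uphalf_half; lia.
- by rewrite uphalf_half /k; case: (odd g) g_eq n_eq => /= g_eq n_eq; nia.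
Qed.
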